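(* Let $\widehat{H}\in\mathbb{R}^{n\times n}$ be a symmetric positive semidefinite approximation of $H = A^\top A$, and let $E = H-\widehat{H}$. Then $$\kappa_2\left((I+\widehat{H})^{-1/2}(I+H)(I+\widehat{H})^{-1/2}\right) \le \left(1+\|E\|_2\right)^2.$$ If, additionally, $E\succeq 0$, then $$\kappa_2\left((I+\widehat{H})^{-1/2}(I+H)(I+\widehat{H})^{-1/2}\right) \le 1+\|E\|_2.$$
   Context: Setting: $A\in\mathbb{R}^{m\times n}$ with $m\le n$ and $H = A^\top A\in\mathbb{R}^{n\times n}$. The result is deterministic: $\widehat{H}$ need not come from a randomized or low-rank construction. Notation: $\kappa_2(M) = \|M\|_2\|M^{-1}\|_2$ for invertible $M$, with $\|\cdot\|_2$ the spectral norm; $E\succeq 0$ means that the symmetric matrix $E$ is positive semidefinite. *)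

(* Defs.v *)
From mathcomp Require Import all_boot all_order all_algebra.
From mathcomp Require Import all_classical all_reals.

Set Implicit Arguments.
Unset Strict Implicit.
Unset Printing Implicit Defensive.

Import Order.TTheory GRing.Theory Num.Theory.
Local Open Scope classical_set_scope.
Local Open Scope ring_scope.

Definition euclnorm (R : realType) (n : nat) (x : 'cV[R]_n) : R :=
  Num.sqrt (\sum_(i < n) x i 0 ^+ 2).

(* The operator norm induced by [euclnorm]. The set below is nonempty (it
   contains 0) and bounded above, so [sup] is a genuine supremum; in dimension
   0 it is [set 0]. *)
Definition specnorm (R : realType) (m n : nat) (M : 'M[R]_(m, n)) : R :=
  sup [set euclnorm (M *m x) | x in [set x : 'cV[R]_n | euclnorm x <= 1]].

(* Only meaningful for [M \in unitmx], since [invmx M = M] otherwise. *)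
Definition cond2 (R : realType) (n : nat) (M : 'M[R]_n) : R :=
  specnorm M * specnorm (invmx M).

Definition psdmx (R : realType) (n : nat) (M : 'M[R]_n) : Prop :=
  M \is symmetricmx /\ forall x : 'cV[R]_n, 0 <= (x^T *m M *m x) 0 0.

(* A positive semidefinite matrix has exactly one positive semidefinite square
   root, so the choice made by [xget] is forced; when [M] is not positive
   semidefinite the default value 0 is returned. *)
Definition sqrtmx (R : realType) (n : nat) (M : 'M[R]_n) : 'M[R]_n :=
  xget 0 [set S : 'M[R]_n | psdmx S /\ S *m S = M].

(* [M ^ (-1/2)], for [M] positive definite. *)
Definition invsqrtmx (R : realType) (n : nat) (M : 'M[R]_n) : 'M[R]_n :=
  invmx (sqrtmx M).

(* Main.v *)
(** Put [S = (I + Hhat)^(1/2)] and [W = S^-1]. Since [|S y|^2 = |y|^2 + y^T Hhat y],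
    [W] is a contraction, and [P = I + W E W] gives [|P| <= 1 + |E|]. With
    [y = W x], [x^T P x = y^T (I + H) y] while [|x|^2 = y^T (I + Hhat) y], and
    [I + Hhat <= (1 + |E|) (I + H)] because [Hhat = H - E <= H + |E| I]; hence
    [|x|^2 <= (1 + |E|) x^T P x], which bounds [|P^-1|] by [1 + |E|] through
    Cauchy-Schwarz. If [E] is positive semidefinite then [Hhat <= H] and the
    bound on [|P^-1|] improves to 1.

    The square root of a positive semidefinite [M] is [q(M)^2], where the real
    polynomial [q] interpolates the fourth root on the spectrum of [M]:
    it is visibly symmetric and positive semidefinite, and [q(M)^4 = M] can be
    checked after diagonalising [M] over the complex numbers. *)
Require Import Defs.
From mathcomp Require Import all_boot all_order all_algebra.
From mathcomp Require Import all_classical all_reals.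
From mathcomp Require Import complex lra.

Import Order.TTheory GRing.Theory Num.Theory.
Local Open Scope ring_scope.

(** * Preliminaries on symmetric matrices and polynomial interpolation *)

Lemma symmetricmxP {K : fieldType} {n : nat} {M : 'M[K]_n} :
  reflect (M^T = M) (M \is symmetricmx).
Proof.
rewrite is_hermitianmxE expr0 scale1r map_mx_id // eq_sym.
exact: eqP.
Qed.

(** Newton interpolation: a new node [a] is handled by adding a multiple of the polynomial whose
    roots are the earlier nodes, which leaves the values at those nodes unchanged. *)
Lemma poly_interpolation (F : fieldType) (f : F -> F) (s : seq F) :
  exists q : {poly F}, {in s, forall x, q.[x] = f x}.
Proof.
elim: s => [|a s [q qE]]; first by exists 0.
have [as_|as_] := boolP (a \in s).
  by exists q => x; rewrite inE => /predU1P[->|/qE//]; exact: qE.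
pose p : {poly F} := \prod_(y <- s) ('X - y%:P).
have pa : p.[a] != 0 by rewrite -rootE root_prod_XsubC.
exists (q + ((f a - q.[a]) / p.[a])%:P * p) => x.
rewrite inE !hornerE => /predU1P[->|xs]; first by rewrite divfK // addrC subrK.
have /rootP -> : root p x by rewrite root_prod_XsubC.
by rewrite mulr0 addr0 qE.
Qed.

Lemma add_mx11 (K : pzRingType) (A B : 'M[K]_1) : (A + B) 0 0 = A 0 0 + B 0 0.
Proof. by rewrite mxE. Qed.

(** * Euclidean norm, Cauchy-Schwarz and the operator norm *)

Section EuclideanNorm.
Variable R : realType.

Lemma euclnorm_ge0 n (x : 'cV[R]_n) : 0 <= euclnorm x.
Proof. exact: sqrtr_ge0. Qed.

Lemma sqr_euclnorm n (x : 'cV[R]_n) : euclnorm x ^+ 2 = (x^T *m x) 0 0.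
Proof.
rewrite sqr_sqrtr; last by apply: sumr_ge0 => i _; exact: sqr_ge0.
by rewrite mxE; apply: eq_bigr => i _; rewrite mxE expr2.
Qed.

Lemma euclnorm_eq0 n (x : 'cV[R]_n) : (euclnorm x == 0) = (x == 0).
Proof.
rewrite -sqrf_eq0 sqr_euclnorm mxE psumr_eq0; last first.
  by move=> i _; rewrite mxE -expr2 sqr_ge0.
apply/allP/eqP => [h|-> i _]; last by rewrite !mxE mulr0 eqxx.
apply/colP => i; rewrite mxE; apply/eqP.
by have := h i (mem_index_enum _); rewrite mxE -expr2 sqrf_eq0.
Qed.

Lemma euclnorm0 n : euclnorm (0 : 'cV[R]_n) = 0.
Proof. by apply/eqP; rewrite euclnorm_eq0. Qed.

Lemma euclnormZ n (a : R) (x : 'cV[R]_n) :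
  euclnorm (a *: x) = `|a| * euclnorm x.
Proof.
apply/eqP; rewrite -(@eqrXn2 _ 2) ?mulr_ge0 ?euclnorm_ge0 //.
rewrite exprMn !sqr_euclnorm real_normK ?num_real // [(_ *: _)^T]linearZ /= -scalemxAl.
by rewrite -scalemxAr scalerA expr2 mxE.
Qed.

Lemma dotC n (x y : 'cV[R]_n) : (x^T *m y) 0 0 = (y^T *m x) 0 0.
Proof. by rewrite -[in RHS](trmxK x) -trmx_mul [RHS]mxE. Qed.

Lemma sqr_euclnormD n (x y : 'cV[R]_n) :
  euclnorm (x + y) ^+ 2 =
  euclnorm x ^+ 2 + (x^T *m y) 0 0 *+ 2 + euclnorm y ^+ 2.
Proof.
rewrite !sqr_euclnorm [(_ + _)^T]linearD /= mulmxDl !mulmxDr !add_mx11 (dotC _ y x).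
by rewrite mulr2n !addrA.
Qed.

Lemma dot_le n (x y : 'cV[R]_n) : (x^T *m y) 0 0 <= euclnorm x * euclnorm y.
Proof.
have [->|x0] := eqVneq x 0; first by rewrite trmx0 mul0mx mxE euclnorm0 mul0r.
have [->|y0] := eqVneq y 0; first by rewrite mulmx0 mxE euclnorm0 mulr0.
have xy0 : 0 < euclnorm x * euclnorm y.
  by rewrite mulr_gt0 // lt0r euclnorm_ge0 euclnorm_eq0 ?x0 ?y0.
(* Expanding the square of the norm of |y| x - |x| y gives 2 |x| |y| (|x| |y| - x^T y) >= 0, and the
   factor |x| |y| is positive. *)
have := sqr_ge0 (euclnorm (euclnorm y *: x + (- euclnorm x) *: y)).
rewrite sqr_euclnormD !euclnormZ normrN !ger0_norm ?euclnorm_ge0 //.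
rewrite [(_ *: _)^T]linearZ /= -scalemxAl -scalemxAr scalerA mxE => h.
rewrite -(ler_pM2l xy0); lra.
Qed.

Lemma euclnormN n (x : 'cV[R]_n) : euclnorm (- x) = euclnorm x.
Proof. by rewrite -scaleN1r euclnormZ normrN1 mul1r. Qed.

Lemma normr_dot_le n (x y : 'cV[R]_n) :
  `|(x^T *m y) 0 0| <= euclnorm x * euclnorm y.
Proof.
rewrite ler_norml dot_le andbT -(euclnormN _ x) lerNl.
by apply: le_trans (dot_le _ _ _); rewrite [(- _)^T]linearN /= mulNmx [leRHS]mxE.
Qed.

Lemma euclnormD n (x y : 'cV[R]_n) :
  euclnorm (x + y) <= euclnorm x + euclnorm y.
Proof.
rewrite -ler_sqr ?nnegrE ?addr_ge0 ?euclnorm_ge0 // sqr_euclnormD sqrrD.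
by rewrite lerD2r lerD2l lerMn2r dot_le orbT.
Qed.

(** The constant is the Frobenius norm, by Cauchy-Schwarz on each row. It serves to show that the
    supremum defining [specnorm] is over a bounded set. *)
Lemma euclnorm_mulmx_bounded m n (M : 'M[R]_(m, n)) :
  exists2 c : R, 0 <= c & forall x, euclnorm (M *m x) <= c * euclnorm x.
Proof.
exists (Num.sqrt (\sum_i euclnorm (row i M)^T ^+ 2)) => [|x].
  exact: sqrtr_ge0.
rewrite -ler_sqr ?nnegrE ?mulr_ge0 ?euclnorm_ge0 ?sqrtr_ge0 //.
have sq0 k (F : 'I_k -> R) : 0 <= \sum_i F i ^+ 2.
  by apply: sumr_ge0 => i _; exact: sqr_ge0.
rewrite exprMn sqr_sqrtr // sqr_sqrtr //.
rewrite mulr_suml; apply: ler_sum => i _.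
have := normr_dot_le _ (row i M)^T x.
rewrite trmxK -row_mul [X in `|X|]mxE => h.
rewrite -exprMn -real_normK ?num_real //.
by rewrite ler_sqr ?nnegrE // mulr_ge0 ?euclnorm_ge0.
Qed.

Lemma euclnorm_mulmx_le m n (M : 'M[R]_(m, n)) (x : 'cV[R]_n) :
  euclnorm (M *m x) <= specnorm M * euclnorm x.
Proof.
have [->|x0] := eqVneq x 0; first by rewrite mulmx0 !euclnorm0 mulr0.
have xgt0 : 0 < euclnorm x by rewrite lt0r euclnorm_ge0 euclnorm_eq0 x0.
rewrite -ler_pdivrMr // mulrC -[(euclnorm x)^-1]ger0_norm; last first.
  by rewrite invr_ge0 euclnorm_ge0.
rewrite -euclnormZ scalemxAr; apply: ub_le_sup; last first.
  exists ((euclnorm x)^-1 *: x) => //=.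
  by rewrite euclnormZ ger0_norm ?invr_ge0 ?euclnorm_ge0 // mulVf ?gt_eqF.
have [c c0 cM] := euclnorm_mulmx_bounded _ _ M.
exists c => _ [y /= y1 <-].
by apply: le_trans (cM y) _; rewrite -[leRHS]mulr1 ler_wpM2l.
Qed.

Lemma specnorm_le m n (M : 'M[R]_(m, n)) (c : R) : 0 <= c ->
  (forall x, euclnorm (M *m x) <= c * euclnorm x) -> specnorm M <= c.
Proof.
move=> c0 cM; apply: ge_sup; first by exists (euclnorm (M *m 0)), 0 => //=;
  rewrite euclnorm0.
move=> _ [y /= y1 <-].
by apply: le_trans (cM y) _; rewrite -[leRHS]mulr1 ler_wpM2l.
Qed.

Lemma specnorm_ge0 m n (M : 'M[R]_(m, n)) : 0 <= specnorm M.
Proof.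
apply: ub_le_sup; last first.
  by exists 0; rewrite ?mulmx0 /= euclnorm0.
have [c c0 cM] := euclnorm_mulmx_bounded _ _ M.
exists c => _ [y /= y1 <-].
by apply: le_trans (cM y) _; rewrite -[leRHS]mulr1 ler_wpM2l.
Qed.

Lemma quadform_le n (M : 'M[R]_n) (x : 'cV[R]_n) :
  `|(x^T *m M *m x) 0 0| <= specnorm M * euclnorm x ^+ 2.
Proof.
rewrite -mulmxA; apply: le_trans (normr_dot_le _ _ _) _.
rewrite expr2 mulrCA; apply: ler_wpM2l; first exact: euclnorm_ge0.
exact: euclnorm_mulmx_le.
Qed.

End EuclideanNorm.

(** * Invertibility and inverse bound from a coercive quadratic form *)

Section CoerciveMatrix.
Variables (R : realType) (n : nat) (P : 'M[R]_n) (K : R).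
Hypothesis coerP :
  forall x : 'cV[R]_n, euclnorm x ^+ 2 <= K * (x^T *m P *m x) 0 0.

Lemma coercive_unitmx : P \in unitmx.
Proof.
rewrite -row_free_unit; apply: inj_row_free => v vP.
apply: trmx_inj; rewrite trmx0; apply/eqP; rewrite -euclnorm_eq0 -sqrf_eq0.
rewrite eq_le sqr_ge0 andbT; apply: le_trans (coerP _) _.
by rewrite trmxK vP mul0mx mxE mulr0.
Qed.

(** With x = P^-1 y, coercivity and Cauchy-Schwarz give |x|^2 <= K x^T y <= K |x| |y|; then cancel
    |x|. *)
Lemma specnorm_invmx_le : 0 <= K -> specnorm (invmx P) <= K.
Proof.
move=> K0; apply: specnorm_le => // y; set x := invmx P *m y.
have [->|x0] := eqVneq x 0; first by rewrite euclnorm0 mulr_ge0 ?euclnorm_ge0.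
have xgt0 : 0 < euclnorm x by rewrite lt0r euclnorm_ge0 euclnorm_eq0 x0.
rewrite -(ler_pM2l xgt0) -expr2; apply: le_trans (coerP _) _.
rewrite -mulmxA /x mulKVmx ?coercive_unitmx // mulrCA ler_wpM2l //.
exact: dot_le.
Qed.

End CoerciveMatrix.

(** * Spectrum and square root of a positive semidefinite matrix *)

Section Eigen.
Variables (R : realType) (n : nat) (M : 'M[R]_n.+1).
Hypothesis hM : psdmx M.
Let toC := real_complex R : {rmorphism R -> R[i]}.
Let Mc := map_mx toC M.

Lemma map_psdmx_hermsym : Mc \is hermsymmx.
Proof.
case: hM => /symmetricmxP Msym _; apply: realsym_hermsym.
  by apply/symmetricmxP; rewrite /Mc map_trmx Msym.
apply/mxOverP => i j; rewrite mxE; apply/complex_realP; by exists (M i j).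
Qed.

Lemma psdmx_eigenvalue_ge0 (a : R) : eigenvalue M a -> 0 <= a.
Proof.
case/eigenvalueP => v vM v0; case: hM => _ /(_ v^T).
rewrite trmxK vM -scalemxAl [X in _ <= X]mxE -[v in v *m _]trmxK.
by rewrite -sqr_euclnorm pmulr_lge0 // exprn_gt0 // lt0r euclnorm_ge0
  euclnorm_eq0 trmx_eq0 v0.
Qed.

(** Row [j] of the diagonalising matrix is a left eigenvector of [Mc]. Its eigenvalue is real, and
    the characteristic polynomial carries it back to an eigenvalue of [M] over [R], where positivity
    applies. *)
Lemma psdmx_spectral_diag (j : 'I_n.+1) :
  exists2 r : R, 0 <= r & spectral_diag Mc 0 j = toC r.
Proof.
have /hermitian_spectral_diag_real/mxOverP/(_ 0 j)/complex_realP[r rE] :=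
  map_psdmx_hermsym.
exists r => //; apply: psdmx_eigenvalue_ge0.
rewrite eigenvalue_root_char -(fmorph_root toC) map_char_poly.
rewrite -eigenvalue_root_char; apply/eigenvalueP.
have U := spectral_unit Mc.
(* If this row vanished, multiplying by the inverse would make the [j]-th unit row zero. *)
exists (row j (spectralmx Mc)); last first.
  apply/eqP; rewrite rowE => /(congr1 (mulmx^~ (invmx (spectralmx Mc)))).
  rewrite mulmxK // mul0mx => /rowP/(_ j)/eqP.
  by rewrite !mxE !eqxx oner_eq0.
have /hermitian_normalmx/orthomx_spectralP McE := map_psdmx_hermsym.
have {}McE : spectralmx Mc *m Mc = diag_mx (spectral_diag Mc) *m spectralmx Mc.
  have := congr1 (mulmx (spectralmx Mc)) McE.
  by rewrite !mulmxA mulmxV // mul1mx.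
by rewrite -row_mul McE row_mul row_diag_mx -scalemxAl -rowE rE.
Qed.

End Eigen.

Lemma psdmx_fourth_root (R : realType) (n : nat) (M : 'M[R]_n.+1) :
  psdmx M -> exists q : {poly R}, horner_mx M (q ^+ 4) = M.
Proof.
move=> hM; pose toC := real_complex R : {rmorphism R -> R[i]}.
pose Mc := map_mx toC M.
(* The spectrum is real but typed in [R[i]]; [complex.Re] turns it into nodes in [R]. *)
have [q qE] := @poly_interpolation R (fun x => Num.sqrt (Num.sqrt x))
  [seq complex.Re (spectral_diag Mc 0 j) | j : 'I_n.+1].
exists q.
apply: (@map_mx_inj _ _ toC); rewrite map_horner_mx /= -/Mc.
have /hermitian_normalmx/orthomx_spectralP McE := map_psdmx_hermsym _ _ _ hM.
rewrite -/Mc -/toC in McE.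
(* Both sides become conjugates of diagonal matrices by the same spectral matrix, so only q(r)^4 = r
   on each eigenvalue r remains. *)
rewrite [RHS]McE -(congr1 (fun X => horner_mx X _) (esym McE)).
rewrite horner_mx_uconjC ?spectral_unit // horner_mx_diag.
congr (_ *m diag_mx _ *m _).
apply/rowP => j; rewrite mxE.
have [r r0 rE] := psdmx_spectral_diag _ _ _ hM j.
rewrite -/Mc -/toC in rE.
rewrite rE horner_map /= horner_exp qE; last first.
  by apply/mapP; exists j; rewrite ?mem_enum // rE.
by rewrite -[4%N]/(2 * 2)%N exprM !sqr_sqrtr // sqrtr_ge0.
Qed.

Lemma trmx_horner_mx (K : comNzRingType) (n : nat) (M : 'M[K]_n.+1)
    (p : {poly K}) : (horner_mx M p)^T = horner_mx M^T p.
Proof.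
elim/poly_ind: p => [|p c IHp]; first by rewrite !rmorph0 trmx0.
rewrite !rmorphD !rmorphM /= !horner_mx_X !horner_mx_C linearD /= trmx_mul.
by rewrite tr_scalar_mx IHp; congr (_ + _); apply: comm_mx_horner.
Qed.

(** Existence suffices, since [xget] then returns a witness. Using the fourth root B makes B B = B^T
    B positive semidefinite at once, whatever the sign of B. *)
Lemma sqrtmxP (R : realType) (n : nat) (M : 'M[R]_n) : psdmx M ->
  psdmx (sqrtmx M) /\ sqrtmx M *m sqrtmx M = M.
Proof.
move=> hM; suff [S hS] : exists S : 'M[R]_n, psdmx S /\ S *m S = M.
  by rewrite /sqrtmx; case: xgetP => [_ _ //|/(_ S)].
case: n M hM => [|n] M hM.
  (* Dimension 0 is separate because [horner_mx] needs a matrix of size [n.+1]. *)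
  by exists M; split=> //; apply/matrixP => -[].
have [q qM] := psdmx_fourth_root _ _ _ hM.
pose B := horner_mx M q; exists (B *m B).
split; last by rewrite -[RHS]qM !rmorphXn /= -/B !exprSr expr0 mul1r !mulmxA.
have BT : B^T = B.
  by rewrite trmx_horner_mx; case: hM => /symmetricmxP ->.
split; first by apply/symmetricmxP; rewrite trmx_mul BT.
move=> x; rewrite -[B in x^T *m (B *m _)]BT mulmxA -trmx_mul -mulmxA.
by rewrite -sqr_euclnorm sqr_ge0.
Qed.

(** * Bounds on P, on its inverse, and on the condition number *)

Theorem theorem5 (R : realType) (m n : nat) (hmn : (m <= n)%N)
    (A : 'M[R]_(m, n)) (Hhat : 'M[R]_n) (hHhat : psdmx Hhat) :
  let H : 'M[R]_n := A^T *m A in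
  let E : 'M[R]_n := H - Hhat in
  let P : 'M[R]_n :=
    invsqrtmx (1%:M + Hhat) *m (1%:M + H) *m invsqrtmx (1%:M + Hhat) in
  cond2 P <= (1 + specnorm E) ^+ 2 /\
  (psdmx E -> cond2 P <= 1 + specnorm E).
Proof.
move=> H E P; case: (hHhat) => /symmetricmxP HhatT Hhat0.
have quadI (x : 'cV[R]_n) (B : 'M[R]_n) : (x^T *m (1%:M + B) *m x) 0 0 =
    euclnorm x ^+ 2 + (x^T *m B *m x) 0 0.
  by rewrite mulmxDr mulmx1 mulmxDl add_mx11 sqr_euclnorm.
have hI : psdmx (1%:M + Hhat).
  split; first by apply/symmetricmxP; rewrite linearD /= trmx1 HhatT.
  by move=> x; rewrite quadI addr_ge0 ?sqr_ge0.
have [[/symmetricmxP ST _] SS] := sqrtmxP _ _ _ hI.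
set S := sqrtmx _ in ST SS.
have Su : S \in unitmx.
  (* S S = I + Hhat is coercive with constant 1, hence invertible. *)
  suff : S *m S \in unitmx by rewrite unitmx_mul => /andP[].
  rewrite SS; apply: (coercive_unitmx _ _ _ 1) => x.
  by rewrite mul1r quadI lerDl.
pose W := invmx S; have WT : W^T = W by rewrite /W trmx_inv ST.
have {}SnormE (y : 'cV[R]_n) :
    euclnorm (S *m y) ^+ 2 = euclnorm y ^+ 2 + (y^T *m Hhat *m y) 0 0.
  by rewrite -quadI -SS sqr_euclnorm trmx_mul ST !mulmxA.
have Wle (x : 'cV[R]_n) : euclnorm (W *m x) <= euclnorm x.
  rewrite -ler_sqr ?nnegrE ?euclnorm_ge0 //.
  by rewrite -[in leRHS](mulKVmx Su x) SnormE lerDl.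
have PE : P = 1%:M + W *m E *m W.
  have -> : P = W *m (S *m S + E) *m W.
    by rewrite SS /E addrCA addrK [H + _]addrC.
  by rewrite mulmxDr mulmxDl !mulmxA mulVmx // mul1mx mulmxV.
set e := specnorm E; have e0 : 0 <= e := specnorm_ge0 _ _ _ E.
have Ple : specnorm P <= 1 + e.
  apply: specnorm_le => [|x]; first by rewrite addr_ge0.
  rewrite PE mulmxDl mul1mx; apply: le_trans (euclnormD _ _ _ _) _.
  rewrite mulrDl mul1r lerD2l -!mulmxA.
  apply: le_trans (Wle _) _; apply: le_trans (euclnorm_mulmx_le _ _ _ _ _) _.
  by rewrite ler_wpM2l.
have quadP (x : 'cV[R]_n) (y := W *m x) : (x^T *m P *m x) 0 0 =
    euclnorm y ^+ 2 + (y^T *m Hhat *m y) 0 0 + (y^T *m E *m y) 0 0.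
  have -> : x^T *m P *m x = y^T *m (1%:M + H) *m y.
    by rewrite /y trmx_mul WT /P !mulmxA.
  by rewrite quadI -addrA -add_mx11 -mulmxDl -mulmxDr /E subrKC.
have xE x : euclnorm x ^+ 2 =
    euclnorm (W *m x) ^+ 2 + ((W *m x)^T *m Hhat *m (W *m x)) 0 0.
  by rewrite -SnormE mulKVmx.
(* The sum is y^T H y = |A y|^2. *)
have H0 (y : 'cV[R]_n) :
    0 <= (y^T *m Hhat *m y) 0 0 + (y^T *m E *m y) 0 0.
  rewrite -add_mx11 -mulmxDl -mulmxDr /E subrKC /H.
  by rewrite mulmxA -trmx_mul -mulmxA -sqr_euclnorm sqr_ge0.
split.
  rewrite expr2; apply: ler_pM; rewrite ?specnorm_ge0 //.
  apply: specnorm_invmx_le; last by rewrite addr_ge0.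
  move=> x; rewrite quadP xE.
  have := quadform_le _ _ E (W *m x); have := H0 (W *m x).
  set h := (_ *m Hhat *m _) 0 0; set f := (_ *m E *m _) 0 0.
  rewrite -/e ler_norml => hf /andP[fl fr].
  (* With y = W x, the right side minus the left is (f + e |y|^2) + e (h + f), and both terms are
     nonnegative. *)
  nra.
case=> _ E0; rewrite -[leRHS]mulr1.
apply: ler_pM; rewrite ?specnorm_ge0 //.
(* Here P is coercive with constant 1, since y^T E y >= 0 is exactly the excess of x^T P x over
   |x|^2. *)
apply: specnorm_invmx_le => // x.
by rewrite mul1r quadP xE lerDl.
Qed.
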